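(* Let $\mathcal A$ and $\mathcal B$ be unital $^*$-algebras over $\mathsf C$ such that there exists a $(\mathcal B$-$\mathcal A)$-bimodule $\mathfrak X$ with maps $\langle\cdot,\cdot\rangle_{\mathcal A}:\mathfrak X\times\mathfrak X\to\mathcal A$ and ${}_{\mathcal B}\langle\cdot,\cdot\rangle:\mathfrak X\times\mathfrak X\to\mathcal B$ satisfying X1, X2, X3, X5, X6, as well as Y1, Y2, Y3, Y5, Y6 and E3 (no positivity being required). Then the centers of $\mathcal A$ and $\mathcal B$ are $^*$-isomorphic.
   Context: $\mathsf R$ is an ordered ring (commutative ring with $1\ne0$ and a subset $\mathsf P$ closed under sums and products such that $\mathsf R$ is the disjoint union $-\mathsf P\cup\{0\}\cup\mathsf P$), and $\mathsf C=\mathsf R(\mathrm i)=\mathsf R\oplus\mathrm i\mathsf R$, $\mathrm i^2=-1$, with the usual conjugation. A $^*$-algebra over $\mathsf C$ is an associative $\mathsf C$-algebra with an antilinear involution satisfying $(AB)^*=B^*A^*$. The center of a $^*$-algebra is a $^*$-subalgebra. A $(\mathcal B$-$\mathcal A)$-bimodule is a $\mathsf C$-module $\mathfrak X$ with commuting $\mathsf C$-linear left $\mathcal B$-action and right $\mathcal A$-action. The axioms, for all $x,y,z\in\mathfrak X$, $A\in\mathcal A$, $B\in\mathcal B$: X1) $\langle\cdot,\cdot\rangle_{\mathcal A}$ is $\mathsf C$-linear in the second argument; X2) $\langle x,y\rangle_{\mathcal A}=\langle y,x\rangle_{\mathcal A}^*$; X3) $\langle x,y\cdot A\rangle_{\mathcal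 A}=\langle x,y\rangle_{\mathcal A}A$; X5) $\langle x,B\cdot y\rangle_{\mathcal A}=\langle B^*\cdot x,y\rangle_{\mathcal A}$; X6) the $\mathsf C$-span of all $\langle x,y\rangle_{\mathcal A}$ is $\mathcal A$. Y1) ${}_{\mathcal B}\langle\cdot,\cdot\rangle$ is $\mathsf C$-linear in the first argument; Y2) ${}_{\mathcal B}\langle x,y\rangle={}_{\mathcal B}\langle y,x\rangle^*$; Y3) ${}_{\mathcal B}\langle B\cdot x,y\rangle=B\,{}_{\mathcal B}\langle x,y\rangle$; Y5) ${}_{\mathcal B}\langle x\cdot A,y\rangle={}_{\mathcal B}\langle x,y\cdot A^*\rangle$; Y6) the $\mathsf C$-span of all ${}_{\mathcal B}\langle x,y\rangle$ is $\mathcal B$. E3) ${}_{\mathcal B}\langle x,y\rangle\cdot z=x\cdot\langle y,z\rangle_{\mathcal A}$. *)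

(* Defs.v *)
(* Ordered rings are rendered by MathComp's realDomainType, totally ordered
   commutative rings with 1 != 0; such rings are integral domains, which also
   follows from the positive-cone axioms. *)
From HB Require Import structures.
From mathcomp Require Import all_boot all_order all_algebra.
From mathcomp Require Import boolp.
From mathcomp Require Import complex.

Set Implicit Arguments.
Unset Strict Implicit.
Unset Printing Implicit Defensive.

Import GRing.Theory.
Local Open Scope ring_scope.

(* R(i) = R + iR.  The library puts a ring structure on R[i] only when R is a
   field, hence the alias: same carrier, addition, multiplication (mulc) and
   conjugation (conjc), over any nonzero commutative ring R. *)
Definition gaussian (R : Type) : Type := complex R.

HB.instance Definition _ (R : comNzRingType) :=
  GRing.Zmodule.copy (gaussian R) (complex R).

Section GaussianRing.
Variable R : comNzRingType.

Fact gaussian_mul1 :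
  left_id (Complex 1 0 : gaussian R) (@ComplexField.mulc R).
Proof. by case=> a b /=; rewrite !mul1r !mul0r subr0 addr0. Qed.

Fact gaussian_mulDl :
  left_distributive (@ComplexField.mulc R : gaussian R -> _ -> _) +%R.
Proof.
case=> [a b] [c d] [e f]; congr Complex; rewrite /= !mulrDl ?opprD addrACA //.
Qed.

Fact gaussian_1_neq0 : (Complex 1 0 : gaussian R) != 0.
Proof. by apply/eqP => -[] /eqP; rewrite oner_eq0. Qed.

HB.instance Definition _ := GRing.Zmodule_isComNzRing.Build (gaussian R)
  (@ComplexField.mulcA R) (@ComplexField.mulcC R)
  gaussian_mul1 gaussian_mulDl gaussian_1_neq0.

End GaussianRing.

Definition gconj (R : comNzRingType) (z : gaussian R) : gaussian R := conjc z.

(* Unital *-algebras.  The library's algType is not used because it excludes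
   the zero algebra. *)
Record starAlgType (R : comNzRingType) : Type := StarAlgebra {
  star_lmod : lmodType (gaussian R);
  star_one : star_lmod;
  star_mul : star_lmod -> star_lmod -> star_lmod;
  star_op : star_lmod -> star_lmod;
  star_mulA : associative star_mul;
  star_mul1l : left_id star_one star_mul;
  star_mul1r : right_id star_one star_mul;
  star_mulDl : left_distributive star_mul +%R;
  star_mulDr : right_distributive star_mul +%R;
  star_mulZl : forall (c : gaussian R) a b,
    c *: star_mul a b = star_mul (c *: a) b;
  star_mulZr : forall (c : gaussian R) a b,
    c *: star_mul a b = star_mul a (c *: b);
  star_opK : involutive star_op;
  star_opD : forall a b, star_op (a + b) = star_op a + star_op b;
  star_opZ : forall (c : gaussian R) a, star_op (c *: a) = gconj c *: star_op a;
  star_opM : forall a b, star_op (star_mul a b) = star_mul (star_op b) (star_op a)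
}.

Definition star_sort (R : comNzRingType) (A : starAlgType R) : Type := star_lmod A.
Coercion star_sort : starAlgType >-> Sortclass.

HB.instance Definition _ (R : comNzRingType) (A : starAlgType R) :=
  GRing.Lmodule.copy (star_sort A) (star_lmod A).
HB.instance Definition _ (R : comNzRingType) (A : starAlgType R) :=
  GRing.Zmodule_isPzRing.Build (star_sort A) (@star_mulA R A)
    (@star_mul1l R A) (@star_mul1r R A) (@star_mulDl R A) (@star_mulDr R A).

Definition star (R : comNzRingType) (A : starAlgType R) (a : A) : A := star_op a.

Section StarAlgebraTheory.
Variables (R : comNzRingType) (A : starAlgType R).
Implicit Types (c : gaussian R) (a b : A).

Lemma starAl c a b : c *: (a * b) = (c *: a) * b.
Proof. exact: star_mulZl. Qed.
Lemma starAr c a b : c *: (a * b) = a * (c *: b).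
Proof. exact: star_mulZr. Qed.
Lemma starK : involutive (@star R A).
Proof. exact: star_opK. Qed.
Lemma starD a b : star (a + b) = star a + star b.
Proof. exact: star_opD. Qed.
Lemma starZ c a : star (c *: a) = gconj c *: star a.
Proof. exact: star_opZ. Qed.
Lemma starM a b : star (a * b) = star b * star a.
Proof. exact: star_opM. Qed.

End StarAlgebraTheory.

Section Center.
Variables (R : comNzRingType) (A : starAlgType R).

Definition central : {pred A} := [pred a | `[< forall b : A, a * b = b * a >]].

Lemma centralP (a : A) : reflect (forall b : A, a * b = b * a) (a \in central).
Proof. exact: asboolP. Qed.

Record central_sub : Type := Central { central_val : A; _ : central_val \in central }.

HB.instance Definition _ := [isSub for central_val].
HB.instance Definition _ := [Choice of central_sub by <:].

Fact central1 : 1 \in central.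
Proof. by apply/centralP => b; rewrite mul1r mulr1. Qed.

Fact centralM (a b : A) : a \in central -> b \in central -> a * b \in central.
Proof.
move=> /centralP ha /centralP hb; apply/centralP => d.
by rewrite -mulrA hb mulrA ha mulrA.
Qed.

Fact central_submod : submod_closed central.
Proof.
split; first by apply/centralP => b; rewrite mul0r mulr0.
move=> c x y /centralP hx /centralP hy; apply/centralP => b.
by rewrite mulrDl mulrDr -starAl hx starAr hy.
Qed.

Fact central_star (a : A) : a \in central -> star a \in central.
Proof.
move=> /centralP ha; apply/centralP => b.
by rewrite -[b]starK -!starM ha.
Qed.

HB.instance Definition _ :=
  GRing.isSubmodClosed.Build (gaussian R) A central central_submod.
HB.instance Definition _ := [SubChoice_isSubLmodule of central_sub by <:].

Definition center_one : central_sub := Central central1.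
Definition center_mul (x y : central_sub) : central_sub :=
  Central (centralM (valP x) (valP y)).
Definition center_star (x : central_sub) : central_sub :=
  Central (central_star (valP x)).

Definition center : starAlgType R.
Proof.
apply: (@StarAlgebra R central_sub center_one center_mul center_star).
- by move=> x y z; apply: val_inj; rewrite /= mulrA.
- by move=> x; apply: val_inj; rewrite /= mul1r.
- by move=> x; apply: val_inj; rewrite /= mulr1.
- by move=> x y z; apply: val_inj; rewrite /= mulrDl.
- by move=> x y z; apply: val_inj; rewrite /= mulrDr.
- by move=> c x y; apply: val_inj; rewrite /= starAl.
- by move=> c x y; apply: val_inj; rewrite /= starAr.
- by move=> x; apply: val_inj; rewrite /= starK.
- by move=> x y; apply: val_inj; rewrite /= starD.
- by move=> c x; apply: val_inj; rewrite /= starZ.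
- by move=> x y; apply: val_inj; rewrite /= starM.
Defined.

End Center.

Arguments central {R} A _.

Definition star_isomorphic (R : comNzRingType) (A B : starAlgType R) : Prop :=
  exists f : A -> B,
    [/\ bijective f, linear f, monoid_morphism f
      & forall a : A, f (star a) = star (f a)].

Section Bimodule.
Variables (R : comNzRingType) (A B : starAlgType R).
Variable X : lmodType (gaussian R).
Variables (lact : B -> X -> X) (ract : X -> A -> X).
Variables (ipA : X -> X -> A) (ipB : X -> X -> B).

(* The units of B and A are not required to act as the identity. *)
Record is_bimodule : Prop := IsBimodule {
  lact_linearl : forall x, linear (lact^~ x);
  lact_linearr : forall b, linear (lact b);
  lactM : forall b b' x, lact (b * b') x = lact b (lact b' x);
  ract_linearl : forall a, linear (ract^~ a);
  ract_linearr : forall x, linear (ract x);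
  ractM : forall x a a', ract x (a * a') = ract (ract x a) a';
  lract : forall b x a, lact b (ract x a) = ract (lact b x) a
}.

Record axioms_X : Prop := AxiomsX {
  X1 : forall x, linear (ipA x);
  X2 : forall x y, ipA x y = star (ipA y x);
  X3 : forall x y a, ipA x (ract y a) = ipA x y * a;
  X5 : forall x y b, ipA x (lact b y) = ipA (lact (star b) x) y;
  X6 : forall a, exists (n : nat) (c : 'I_n -> gaussian R) (x y : 'I_n -> X),
         a = \sum_(i < n) c i *: ipA (x i) (y i)
}.

Record axioms_Y : Prop := AxiomsY {
  Y1 : forall y, linear (ipB^~ y);
  Y2 : forall x y, ipB x y = star (ipB y x);
  Y3 : forall x y b, ipB (lact b x) y = b * ipB x y;
  Y5 : forall x y a, ipB (ract x a) y = ipB x (ract y (star a));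
  Y6 : forall b, exists (n : nat) (c : 'I_n -> gaussian R) (x y : 'I_n -> X),
         b = \sum_(i < n) c i *: ipB (x i) (y i)
}.

Definition axiom_E3 : Prop :=
  forall x y z, lact (ipB x y) z = ract x (ipA y z).

End Bimodule.

(* Main.v *)
(* A central [a] of [A] corresponds to the central [b] of [B] that satisfies
   [b . x = x . a] for all [x].  Fullness (X6, Y6) and E3 make both actions
   faithful; writing [1] as a combination of the inner products
   [B<x_i, y_i>], the element [b] is the same combination of the
   [B<x_i . a, y_i>], and symmetrically for [a] given [b]. *)
From HB Require Import structures.
Require Import Defs.
From mathcomp Require Import all_boot all_order all_algebra.
From mathcomp Require Import boolp.

Set Implicit Arguments.
Unset Strict Implicit.
Unset Printing Implicit Defensive.

Import GRing.Theory.
Local Open Scope ring_scope.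

Lemma linear_comb (K : pzRingType) (U V : lmodType K) (f : U -> V) n
    (c : 'I_n -> K) (u : 'I_n -> U) :
  linear f -> f (\sum_(i < n) c i *: u i) = \sum_(i < n) c i *: f (u i).
Proof.
move=> linf; pose lf : {linear U -> V} :=
  HB.pack f (GRing.isLinear.Build _ _ _ _ f linf).
by rewrite -[LHS]/(lf _) linear_sum; apply: eq_bigr => i _; rewrite linearZ.
Qed.

Lemma mulr_linearl (R : comNzRingType) (A : starAlgType R) (a : A) :
  linear (fun x : A => x * a).
Proof. by move=> c x y; rewrite mulrDl -starAl. Qed.

Lemma mulr_linearr (R : comNzRingType) (A : starAlgType R) (a : A) :
  linear (fun x : A => a * x).
Proof. by move=> c x y; rewrite mulrDr -starAr. Qed.

Section CenterCorrespondence.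
Variables (R : comNzRingType) (A B : starAlgType R) (X : lmodType (gaussian R)).
Variables (lact : B -> X -> X) (ract : X -> A -> X).
Variables (ipA : X -> X -> A) (ipB : X -> X -> B).
Hypotheses (bimod : is_bimodule lact ract) (axX : axioms_X lact ract ipA).
Hypotheses (axY : axioms_Y lact ract ipB) (E3 : axiom_E3 lact ract ipA ipB).

Definition intertwines (a : A) (b : B) : Prop := forall x, lact b x = ract x a.

(** By fullness of [ipB] and E3, [lact b x] is a combination of vectors [ract u (ipA v x)], and each
    of these is fixed by the right unit. *)
Lemma ract1_lact (b : B) x : ract (lact b x) 1 = lact b x.
Proof.
have [n [c [u [v ->]]]] := Y6 axY b.
rewrite (linear_comb _ _ (lact_linearl bimod x)).
rewrite (linear_comb _ _ (ract_linearl bimod 1)).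
by apply: eq_bigr => i _; rewrite E3 -(ractM bimod) mulr1.
Qed.

Lemma lact1_ract (a : A) x : lact 1 (ract x a) = ract x a.
Proof.
have [n [c [u [v ->]]]] := X6 axX a.
rewrite (linear_comb _ _ (ract_linearr bimod x)).
rewrite (linear_comb _ _ (lact_linearr bimod 1)).
by apply: eq_bigr => i _; rewrite -E3 -(lactM bimod) mul1r.
Qed.

(* The units need not act as the identity, but they act by the same map. *)
Lemma intertwines1 : intertwines 1 1.
Proof. by move=> x; rewrite -ract1_lact -(lract bimod) lact1_ract. Qed.

(** Expanding the right factor of [b * 1] by fullness turns [b] into a combination of terms
    [ipB (lact b u) v], which see only the action of [b]. *)
Lemma lact_inj (b b' : B) : (forall x, lact b x = lact b' x) -> b = b'.
Proof.
move=> eqbb'; have [n [c [u [v def1]]]] := Y6 axY 1.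
rewrite -[b]mulr1 -[b']mulr1 def1 !(linear_comb _ _ (mulr_linearr _)).
by apply: eq_bigr => i _; rewrite -!(Y3 axY) eqbb'.
Qed.

Lemma ract_inj (a a' : A) : (forall x, ract x a = ract x a') -> a = a'.
Proof.
move=> eqaa'; have [n [c [u [v def1]]]] := X6 axX 1.
rewrite -[a]mul1r -[a']mul1r def1 !(linear_comb _ _ (mulr_linearl _)).
by apply: eq_bigr => i _; rewrite -!(X3 axX) eqaa'.
Qed.

(** Expanding [1] by fullness and applying E3 writes [lact 1 x] as a combination of vectors
    [ract u (ipA v x)]. *)
Lemma ipA_nondegenerate x y :
  (forall z, ipA z x = ipA z y) -> lact 1 x = lact 1 y.
Proof.
move=> eqxy; have [n [c [u [v ->]]]] := Y6 axY 1.
rewrite !(linear_comb _ _ (lact_linearl bimod _)).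
by apply: eq_bigr => i _; rewrite !E3 eqxy.
Qed.

Lemma intertwines_funct a b b' : intertwines a b -> intertwines a b' -> b = b'.
Proof. by move=> ab ab'; apply: lact_inj => x; rewrite ab ab'. Qed.

Lemma intertwines_inj a a' b : intertwines a b -> intertwines a' b -> a = a'.
Proof. by move=> ab a'b; apply: ract_inj => x; rewrite -ab -a'b. Qed.

(** The action of [b] is a right multiplication, so it commutes with every left action; faithfulness
    does the rest. *)
Lemma intertwines_centralr a b : intertwines a b -> b \in central B.
Proof.
move=> ab; apply/centralP => d; apply: lact_inj => x.
by rewrite !(lactM bimod) !ab (lract bimod).
Qed.

Lemma intertwines_centrall a b : intertwines a b -> a \in central A.
Proof.
move=> ab; apply/centralP => d; apply: ract_inj => x.
by rewrite !(ractM bimod) -!ab (lract bimod).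
Qed.

Lemma intertwines_existsr a :
  a \in central A -> exists b, intertwines a b.
Proof.
move=> /centralP ca; have [n [c [u [v def1]]]] := Y6 axY 1.
exists (\sum_(i < n) c i *: ipB (ract (u i) a) (v i)) => z.
(* Inserting the left unit allows its expansion; it acts as the right unit, which [a] absorbs. *)
transitivity (ract (lact 1 z) a); last first.
  by rewrite intertwines1 -(ractM bimod) mul1r.
rewrite def1 !(linear_comb _ _ (lact_linearl bimod z)).
rewrite (linear_comb _ _ (ract_linearl bimod a)).
(* Centrality moves [a] past [ipA (v i) z]. *)
by apply: eq_bigr => i _; rewrite !E3 -!(ractM bimod) ca.
Qed.

Lemma intertwines_existsl b :
  b \in central B -> exists a, intertwines a b.
Proof.
move=> /centralP cb; have [n [c [u [v def1]]]] := X6 axX 1.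
exists (\sum_(i < n) c i *: ipA (u i) (lact b (v i))) => z.
(* Mirror image: the right unit is inserted, then expanded. *)
transitivity (lact b (ract z 1)).
  by rewrite -intertwines1 -(lactM bimod) mulr1.
rewrite def1 !(linear_comb _ _ (ract_linearr bimod z)).
rewrite (linear_comb _ _ (lact_linearr bimod b)).
by apply: eq_bigr => i _; rewrite -!E3 -!(lactM bimod) cb.
Qed.

Lemma intertwines_linear c a a' b b' :
  intertwines a b -> intertwines a' b' ->
  intertwines (c *: a + a') (c *: b + b').
Proof.
move=> ab ab' x.
by rewrite (lact_linearl bimod) (ract_linearr bimod) ab ab'.
Qed.

(** Passing from left to right actions reverses products; centrality of [a] restores the order. *)
Lemma intertwinesM a a' b b' :
  intertwines a b -> intertwines a' b' -> intertwines (a * a') (b * b').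
Proof.
move=> ab ab' x; have /centralP ca := intertwines_centrall ab.
by rewrite (lactM bimod) ab ab' -(ractM bimod) ca.
Qed.

Lemma intertwines_star a b : intertwines a b -> intertwines (star a) (star b).
Proof.
move=> ab x.
have /central_star/centralP cas := intertwines_centrall ab.
(* Both sides take the form [lact 1 _], the only part of a vector that the inner products detect.
   Then, writing [<,>] for [ipA]: <z, b* x> = <b z, x> = <z a, x> = a* <z, x> = <z, x> a* = <z, x
   a*>. *)
rewrite -[star b]mul1r (lactM bimod) -[RHS]lact1_ract.
apply: ipA_nondegenerate => z; rewrite (X5 axX) starK ab (X3 axX).
by rewrite (X2 axX) (X3 axX) starM -(X2 axX) cas.
Qed.

Lemma center_star_isomorphic : star_isomorphic (center A) (center B).
Proof.
have existsr (a : central_sub A) :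
    {b : central_sub B | intertwines (val a) (val b)}.
  apply: cid; have [b ab] := intertwines_existsr (valP a).
  by exists (Central (intertwines_centralr ab)).
have existsl (b : central_sub B) :
    {a : central_sub A | intertwines (val a) (val b)}.
  apply: cid; have [a ab] := intertwines_existsl (valP b).
  by exists (Central (intertwines_centrall ab)).
pose f a := sval (existsr a); pose g b := sval (existsl b).
have fP a : intertwines (val a) (val (f a)) by exact: svalP (existsr a).
have gP b : intertwines (val (g b)) (val b) by exact: svalP (existsl b).
(* By uniqueness, each law for [f] reduces to compatibility of [intertwines] with the corresponding
   operation. *)
have f_eq a b : intertwines (val a) (val b) -> f a = b.
  by move=> ab; apply: val_inj; apply: intertwines_funct ab.
exists f; split.
- exists g => [a|b]; last exact: f_eq.
  by apply: val_inj; apply: intertwines_inj (gP _) (fP a).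
- by move=> c a a'; apply: f_eq; apply: intertwines_linear.
- split; first by apply: f_eq; apply: intertwines1.
  by move=> a a'; apply: f_eq; apply: intertwinesM.
- by move=> a; apply: f_eq; apply: intertwines_star.
Qed.

End CenterCorrespondence.

Theorem proposition7p6 (R : realDomainType) (A B : starAlgType R) :
  (exists (X : lmodType (gaussian R)) (lact : B -> X -> X) (ract : X -> A -> X)
          (ipA : X -> X -> A) (ipB : X -> X -> B),
     [/\ is_bimodule lact ract,
         axioms_X lact ract ipA,
         axioms_Y lact ract ipB
       & axiom_E3 lact ract ipA ipB]) ->
  star_isomorphic (center A) (center B).
Proof.
case=> X [lact [ract [ipA [ipB [bimod axX axY E3]]]]].
exact: center_star_isomorphic bimod axX axY E3.
Qed.
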